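(* Let $\mathscr{F}\subseteq\mathscr{P}(\omega)$ be an $\omega$-closed family, and let $(i,i,F_1)$ and $(j,j,F_2)$ be nonzero idempotents of $\boldsymbol{B}_{\mathbb{Z}}^{\mathscr{F}}$ ($i,j\in\mathbb{Z}$, $F_1,F_2\in\mathscr{F}\setminus\{\varnothing\}$). Then $(i,i,F_1)\preccurlyeq(j,j,F_2)$ in $E(\boldsymbol{B}_{\mathbb{Z}}^{\mathscr{F}})$ if and only if $i\geqslant j$ and $F_1\subseteq j-i+F_2$.
   Context: $\omega$ is the set of non-negative integers and $\mathscr{P}(\omega)$ is the family of all its subsets. For $n\in\mathbb{Z}$ and $A\subseteq\mathbb{Z}$ put $n+A=\{n+a: a\in A\}$ (so $n+\varnothing=\varnothing$). A family $\mathscr{F}\subseteq\mathscr{P}(\omega)$ is $\omega$-closed if $F_1\cap(-n+F_2)\in\mathscr{F}$ for all $n\in\omega$ and $F_1,F_2\in\mathscr{F}$. For an $\omega$-closed family $\mathscr{F}$, the set $\mathbb{Z}\times\mathbb{Z}\times\mathscr{F}$ carries the associative operation $$(i_1,j_1,F_1)\cdot(i_2,j_2,F_2)=\begin{cases}(i_1-j_1+i_2,\;j_2,\;(j_1-i_2+F_1)\cap F_2), & j_1<i_2;\\ (i_1,\;j_2,\;F_1\cap F_2), & j_1=i_2;\\ (i_1,\;j_1-i_2+j_2,\;F_1\cap(i_2-j_1+F_2)), & j_1>i_2.\end{cases}$$ If $\varnothing\in\mathscr{F}$, then $\boldsymbol{I}=\{(i,j,\varnothing): i,j\in\mathbb{Z}\}$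 is an ideal and $\boldsymbol{B}_{\mathbb{Z}}^{\mathscr{F}}$ is defined as the Rees quotient $(\mathbb{Z}\times\mathbb{Z}\times\mathscr{F},\cdot)/\boldsymbol{I}$ ($\boldsymbol{I}$ is collapsed to one element, the zero); if $\varnothing\notin\mathscr{F}$, then $\boldsymbol{B}_{\mathbb{Z}}^{\mathscr{F}}=(\mathbb{Z}\times\mathbb{Z}\times\mathscr{F},\cdot)$. The nonzero elements of $\boldsymbol{B}_{\mathbb{Z}}^{\mathscr{F}}$ are exactly the triples $(i,j,F)$ with $i,j\in\mathbb{Z}$, $F\in\mathscr{F}$, $F\neq\varnothing$; such an element is an idempotent if and only if $i=j$. $E(S)$ denotes the set of idempotents of a semigroup $S$, and the natural partial order on $E(S)$ is: $e\preccurlyeq f$ if and only if $ef=fe=e$. *)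

(* Defs.v *)
From HB Require Import structures.
From mathcomp Require Import all_boot all_order all_algebra.
From mathcomp Require Import zify.
From mathcomp Require Import boolp classical_sets.

Set Implicit Arguments.
Unset Strict Implicit.
Unset Printing Implicit Defensive.

Import Order.TTheory GRing.Theory Num.Theory.
Local Open Scope classical_set_scope.
Local Open Scope ring_scope.
Local Open Scope quotient_scope.

Definition idempotents (S : semigroupType) : set S :=
  [set e | (e * e)%g = e].
Arguments idempotents : clear implicits.

(* The order lives on E(S): both arguments are required to be idempotents. *)
Definition natural_le (S : semigroupType) (e f : S) : Prop :=
  [/\ e \in idempotents S, f \in idempotents S, (e * f)%g = e & (f * e)%g = e].

Record ideal (S : semigroupType) := Ideal {
  ideal_set :> set S;
  ideal_nonempty : ideal_set !=set0;
  ideal_mull : forall x y, ideal_set y -> ideal_set (x * y)%g;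
  ideal_mulr : forall x y, ideal_set x -> ideal_set (x * y)%g
}.

Section ReesQuotient.
Variables (S : semigroupType) (I : ideal S).

Definition rees_rel : rel S := fun x y => (x == y) || ((x \in ideal_set I) && (y \in ideal_set I)).

Let rees_refl : reflexive rees_rel.
Proof. by move=> x; rewrite /rees_rel eqxx. Qed.

Let rees_sym : symmetric rees_rel.
Proof. by move=> x y; rewrite /rees_rel eq_sym andbC. Qed.

Let rees_trans : transitive rees_rel.
Proof.
move=> y x z; rewrite /rees_rel => /orP[/eqP-> //|/andP[Ix Iy]].
by case/orP=> [/eqP<-|/andP[_ Iz]]; rewrite Ix ?Iy ?Iz orbT.
Qed.

Canonical rees_equiv := EquivRel rees_rel rees_refl rees_sym rees_trans.

Definition rees_quotient := {eq_quot rees_equiv}.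
HB.instance Definition _ := Choice.on rees_quotient.
HB.instance Definition _ := EqQuotient.on rees_quotient.

Lemma rees_piE (x y : S) :
  (\pi_rees_quotient x == \pi_rees_quotient y) = rees_rel x y.
Proof. exact: (@eqmodE _ rees_equiv). Qed.

Definition rees_mul (a b : rees_quotient) : rees_quotient :=
  \pi_rees_quotient (repr a * repr b)%g.

Lemma rees_mul_pi (x y : S) :
  rees_mul (\pi_rees_quotient x) (\pi_rees_quotient y)
    = \pi_rees_quotient (x * y)%g.
Proof.
have compat (x' x0 y' y0 : S) : rees_rel x' x0 -> rees_rel y' y0 ->
    rees_rel (x' * y')%g (x0 * y0)%g.
  have mulI (a b : S) : (a \in ideal_set I) || (b \in ideal_set I) ->
      (a * b)%g \in ideal_set I.
    by case/orP=> /set_mem h; apply/mem_set;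
      [apply: ideal_mulr | apply: ideal_mull].
  rewrite /rees_rel => /orP[/eqP->|/andP[Ix Ix0]].
    case/orP=> [/eqP->|/andP[Iy Iy0]]; first by rewrite eqxx.
    by rewrite !mulI ?orbT ?Iy ?Iy0 ?orbT.
  by move=> _; rewrite !mulI ?orbT ?Ix ?Ix0.
have rees_repr (z : S) : rees_rel (repr (\pi_rees_quotient z)) z.
  by rewrite -rees_piE reprK.
by apply/eqP; rewrite rees_piE; apply: compat; apply: rees_repr.
Qed.

Lemma rees_mulA : associative rees_mul.
Proof.
move=> a b c; rewrite -[a]reprK -[b]reprK -[c]reprK.
move: (repr a) (repr b) (repr c) => x y z.
by rewrite (rees_mul_pi x y) (rees_mul_pi y z) (rees_mul_pi x)
  (rees_mul_pi _ z) mulgA.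
Qed.

HB.instance Definition _ := isSemigroup.Build rees_quotient rees_mulA.

End ReesQuotient.

(* $\omega$ and its subsets are regarded as subsets of $\mathbb{Z}$. *)
Definition omega : set int := [set n | 0 <= n].

Definition translate (n : int) (A : set int) : set int :=
  [set n + a | a in A].

Definition omega_closed (FF : set (set int)) : Prop :=
  forall n, omega n -> forall F1 F2, FF F1 -> FF F2 ->
    FF (F1 `&` translate (- n) F2).

Definition triple_mul (x y : int * int * set int) : int * int * set int :=
  let: (i1, j1, F1) := x in let: (i2, j2, F2) := y in
  if j1 < i2 then (i1 - j1 + i2, j2, translate (j1 - i2) F1 `&` F2)
  else if j1 == i2 then (i1, j2, F1 `&` F2)
  else (i1, j1 - i2 + j2, F1 `&` translate (i2 - j1) F2).

Lemma translateE n A a : translate n A a <-> A (a - n).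
Proof.
split=> [[b Ab <-]|Aa]; first by rewrite addrC addKr.
by exists (a - n) => //; rewrite addrC subrK.
Qed.

Lemma triple_mulE i1 j1 F1 i2 j2 F2 :
  triple_mul (i1, j1, F1) (i2, j2, F2)
    = (i1 - j1 + Num.max j1 i2, j2 - i2 + Num.max j1 i2,
       translate (j1 - Num.max j1 i2) F1
         `&` translate (i2 - Num.max j1 i2) F2).
Proof.
have translate0 A : translate 0 A = A.
  by apply/seteqP; split=> a; rewrite translateE subr0.
rewrite /triple_mul; case: ltgtP => [lt|gt|<-]; rewrite ?subrr !translate0;
  do 2![congr (_, _) => //]; lia.
Qed.

Lemma triple_mulA : associative triple_mul.
Proof.
move=> [[i1 j1] F1] [[i2 j2] F2] [[i3 j3] F3]; rewrite !triple_mulE.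
congr (_, _, _); try lia.
have eqF (A : set int) a b : a = b -> A a -> A b by move=> ->.
apply/seteqP; split=> a /=.
- move=> [/translateE A1 /translateE[/translateE A2 /translateE A3]].
  split; last by apply/translateE; apply: eqF A3; lia.
  by apply/translateE; split; apply/translateE;
    [apply: eqF A1 | apply: eqF A2]; lia.
- move=> [/translateE[/translateE A1 /translateE A2] /translateE A3].
  split; first by apply/translateE; apply: eqF A1; lia.
  by apply/translateE; split; apply/translateE;
    [apply: eqF A2 | apply: eqF A3]; lia.
Qed.

Section Extension.
Variables (FF : set (set int)) (FFcl : omega_closed FF).

(* [ext FFcl] is $\mathbb{Z}\times\mathbb{Z}\times\mathscr{F}$; the closure
   proof is a parameter because the product depends on it. *)
Definition ext of omega_closed FF : Type := (int * int * FF)%type.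
HB.instance Definition _ := Choice.on (ext FFcl).

Definition ext_triple (x : ext FFcl) : int * int * set int :=
  (x.1.1, x.1.2, val x.2).

Lemma ext_triple_inj : injective ext_triple.
Proof. by move=> [[i j] F] [[k l] G] [-> -> /val_inj->]. Qed.

Lemma triple_mul_closed (x y : ext FFcl) :
  (triple_mul (ext_triple x) (ext_triple y)).2 \in FF.
Proof.
move: x y => [[i1 j1] [F1 h1]] [[i2 j2] [F2 h2]] /=.
move/set_mem: h1 => h1; move/set_mem: h2 => h2; apply/mem_set.
case: ltgtP => [lt|gt|_] /=.
- rewrite setIC -opprB; apply: FFcl => //.
  by rewrite /omega /= subr_ge0 ltW.
- by rewrite -opprB; apply: FFcl => //; rewrite /omega /= subr_ge0 ltW.
- suff -> : F2 = translate (- 0) F2 by apply: FFcl => //; rewrite /omega /=.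
  by apply/seteqP; split=> a; rewrite translateE oppr0 subr0.
Qed.

Definition ext_mul (x y : ext FFcl) : ext FFcl :=
  ((triple_mul (ext_triple x) (ext_triple y)).1, SigSub (triple_mul_closed x y)).

Lemma ext_tripleM x y :
  ext_triple (ext_mul x y) = triple_mul (ext_triple x) (ext_triple y).
Proof.
have pairE (p : int * int * set int) : (p.1.1, p.1.2, p.2) = p.
  by case: p => [[]].
exact: pairE.
Qed.

Lemma ext_mulA : associative ext_mul.
Proof.
by move=> x y z; apply: ext_triple_inj; rewrite !ext_tripleM triple_mulA.
Qed.

HB.instance Definition _ := isSemigroup.Build (ext FFcl) ext_mulA.

Definition ext_empty : set (ext FFcl) := [set x | val x.2 = set0].

Hypothesis FF0 : FF set0.

Lemma ext_empty_nonempty : ext_empty !=set0.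
Proof. by exists ((0, 0), SigSub (mem_set FF0)). Qed.

Lemma ext_empty_mull (x y : ext FFcl) : ext_empty y -> ext_empty (x * y)%g.
Proof.
rewrite -[ext_empty y]/((ext_triple y).2 = set0).
rewrite -[ext_empty _]/((ext_triple (ext_mul x y)).2 = set0) ext_tripleM.
case: (ext_triple x) (ext_triple y) => [[i1 j1] F1] [[i2 j2] F2].
by rewrite triple_mulE /= => ->; rewrite /translate image_set0 setI0.
Qed.

Lemma ext_empty_mulr (x y : ext FFcl) : ext_empty x -> ext_empty (x * y)%g.
Proof.
rewrite -[ext_empty x]/((ext_triple x).2 = set0).
rewrite -[ext_empty _]/((ext_triple (ext_mul x y)).2 = set0) ext_tripleM.
case: (ext_triple x) (ext_triple y) => [[i1 j1] F1] [[i2 j2] F2].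
by rewrite triple_mulE /= => ->; rewrite /translate image_set0 set0I.
Qed.

Definition ext_ideal : ideal (ext FFcl) :=
  Ideal ext_empty_nonempty ext_empty_mull ext_empty_mulr.

End Extension.

Section BZ.
Variables (FF : set (set int)) (FFcl : omega_closed FF).

Definition BZ_case (c : {FF set0} + {~ FF set0}) : semigroupType :=
  match c with
  | left FF0 => rees_quotient (ext_ideal FFcl FF0)
  | right _ => ext FFcl
  end.

Definition BZ_case_of (c : {FF set0} + {~ FF set0}) : ext FFcl -> BZ_case c :=
  match c with
  | left FF0 => fun x => \pi_(rees_quotient (ext_ideal FFcl FF0)) x
  | right _ => fun x => x
  end.

(* $\boldsymbol{B}_{\mathbb{Z}}^{\mathscr{F}}$ *)
Definition BZ : semigroupType := BZ_case (pselect (FF set0)).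

(* The element of [BZ] denoted $(i,j,F)$: the class of the triple in the Rees
   quotient if $\varnothing\in\mathscr{F}$, the triple itself otherwise. *)
Definition BZ_elt (i j : int) (F : FF) : BZ :=
  BZ_case_of (pselect (FF set0)) (i, j, F).

End BZ.

(* Main.v *)
Require Import Defs.
From mathcomp Require Import all_boot all_order all_algebra.
From mathcomp Require Import boolp classical_sets.
Import Order.TTheory GRing.Theory Num.Theory.
Local Open Scope classical_set_scope.
Local Open Scope ring_scope.

(** The product of diagonal triples [(i, i, A)] and [(j, j, B)] is diagonal with index
    [m = max i j], its set being the intersection of [A] shifted by [i - m] and [B] shifted by
    [j - m]. Such products commute, so the order amounts to the single equation [ef = e], solved in
    [triple_mul_diag_idl]. By [BZ_case_of_mul_eq] it may be checked on triples, since the Rees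
    quotient only merges triples with empty set. *)

Lemma translate0 (A : set int) : translate 0 A = A.
Proof. by apply/seteqP; split=> a; rewrite translateE subr0. Qed.

Lemma triple_mul_diag (i j : int) (A B : set int) :
  triple_mul (i, i, A) (j, j, B) =
    (Num.max i j, Num.max i j,
     translate (i - Num.max i j) A `&` translate (j - Num.max i j) B).
Proof. by rewrite triple_mulE !subrr !add0r. Qed.

Lemma triple_mul_diagC (i j : int) (A B : set int) :
  triple_mul (i, i, A) (j, j, B) = triple_mul (j, j, B) (i, i, A).
Proof. by rewrite !triple_mul_diag maxC setIC. Qed.

(** Comparing indices forces the maximum to be [i]; then [A] is shifted by 0, and what remains says
    that intersecting with the shifted [B] leaves [A] unchanged. *)
Lemma triple_mul_diag_idl (i j : int) (A B : set int) :
  triple_mul (i, i, A) (j, j, B) = (i, i, A)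
    <-> j <= i /\ A `<=` translate (j - i) B.
Proof.
rewrite triple_mul_diag; split=> [[maxi _]|[ji AB]].
  rewrite maxi subrr translate0 => /setIidPl AB.
  by split=> //; rewrite -maxi le_max lexx orbT.
by rewrite (max_l ji) subrr translate0; congr (_, _); apply/setIidPl.
Qed.

Section Quotient.
Variables (FF : set (set int)) (FFcl : omega_closed FF).
Implicit Types (x y z : ext FFcl) (c : {FF set0} + {~ FF set0}).

(** Keeping [c] arbitrary allows a case split that treats the Rees quotient and the plain product
    together. *)
Lemma BZ_case_ofM c x y :
  BZ_case_of c (x * y)%g = (BZ_case_of c x * BZ_case_of c y)%g.
Proof. by case: c => [FF0|//]; rewrite /= -rees_mul_pi. Qed.

(** Distinct triples are identified only when both lie in the ideal, so one nonempty set
    suffices. *)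
Lemma BZ_case_of_inj c x y : val y.2 <> set0 ->
  BZ_case_of c x = BZ_case_of c y -> x = y.
Proof.
move=> y0; case: c => [FF0|//] /= /eqP.
by rewrite rees_piE => /orP[/eqP//|/andP[_ /set_mem]].
Qed.

Lemma BZ_case_of_mul_eq c x y z : val z.2 <> set0 ->
  (BZ_case_of c x * BZ_case_of c y)%g = BZ_case_of c z
    <-> triple_mul (ext_triple x) (ext_triple y) = ext_triple z.
Proof.
move=> z0; rewrite -BZ_case_ofM -ext_tripleM.
by split=> [/(BZ_case_of_inj _ _ _ z0)<-|/ext_triple_inj<-].
Qed.

End Quotient.

Theorem mainTheorem5 (FF : set (set int))
    (FFomega : forall F, FF F -> F `<=` omega)
    (FFcl : omega_closed FF)
    (i j : int) (F1 F2 : FF)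
    (F1_neq0 : val F1 <> set0) (F2_neq0 : val F2 <> set0) :
  natural_le (BZ_elt FFcl i i F1) (BZ_elt FFcl j j F2)
    <-> (j <= i /\ val F1 `<=` translate (j - i) (val F2)).
Proof.
have mulE k l m (F G H : FF) : val H <> set0 ->
    (BZ_elt FFcl k k F * BZ_elt FFcl l l G)%g = BZ_elt FFcl m m H
      <-> triple_mul (k, k, val F) (l, l, val G) = (m, m, val H).
  exact: (BZ_case_of_mul_eq _ FFcl _ (k, k, F) (l, l, G) (m, m, H)).
have idem k (F : FF) : val F <> set0 ->
    BZ_elt FFcl k k F \in idempotents (BZ FFcl).
  (* Idempotency is the equation [ef = e] with [e] and [f] equal. *)
  move=> F0; apply/mem_set/mulE => //; apply/triple_mul_diag_idl.
  by rewrite subrr translate0; split.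
rewrite -triple_mul_diag_idl; split=> [[_ _ /mulE ef _]|ef]; first exact: ef.
split; [exact: idem|exact: idem|exact/mulE|].
by apply/mulE => //; rewrite triple_mul_diagC.
Qed.
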